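(* Let $G$ be a countable amenable group and let $A_l,A_r\subseteq G\times G$. Then for any left or right Følner sequence $F$ in $G$, there exists $B\subseteq G$ such that $\overline{d}_F(B)\geq d^*_l(A_l)^2\,d^*_r(A_r)^2$ and $B\times B\subseteq A_lA_l^{-1}\cap A_r^{-1}A_r$.
   Context: ''Countable'' means in bijective correspondence with $\mathbb{N}$. A left Følner sequence in a countable group $G$ is a sequence $(F_N)_{N\in\mathbb{N}}$ of finite nonempty subsets of $G$ such that $\lim_{N\to\infty}\frac{|gF_N\Delta F_N|}{|F_N|}=0$ for all $g\in G$; it is a right Følner sequence if $\lim_{N\to\infty}\frac{|F_Ng\Delta F_N|}{|F_N|}=0$ for all $g\in G$. $G$ is amenable if it has a left Følner sequence (equivalently, a right one). For a sequence $F=(F_N)$ of finite nonempty subsets of $G$ and $E\subseteq G$, $\overline{d}_F(E)=\limsup_{N\to\infty}\frac{|E\cap F_N|}{|F_N|}$. For a subset $E$ of a countable amenable group $K$, $d^*_l(E)$ (resp. $d^*_r(E)$) is the supremum of $\overline{d}_F(E)$ over all left (resp. right) Følner sequences $F$ in $K$; here these densities are taken in $K=G\times G$. $AA^{-1}=\{xy^{-1}:x,y\in A\}$ and $A^{-1}A=\{x^{-1}y:x,y\in A\}$, computed in the group $G\times G$. *)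

(* Defs.v *)
From HB Require Import structures.
From mathcomp Require Import all_boot all_order all_algebra finmap.
From mathcomp Require Import all_classical all_reals all_analysis.

Set Implicit Arguments.
Unset Strict Implicit.
Unset Printing Implicit Defensive.
Import Order.TTheory GRing.Theory Num.Theory.
Import numFieldNormedType.Exports.
Local Open Scope classical_set_scope.
Local Open Scope ring_scope.

(* In bijection with the natural numbers; in particular infinite. *)
Definition countable_group (G : groupType) : Prop :=
  ([set: G] #= [set: nat])%card.

Section Translates.
Variable G : groupType.
Implicit Types (A B : {fset G}) (g : G).

Definition ltranslate g A : {fset G} := [fset (g * x)%g | x in A]%fset.

Definition rtranslate A g : {fset G} := [fset (x * g)%g | x in A]%fset.

Definition fsymdiff A B : {fset G} := ((A `\` B) `|` (B `\` A))%fset.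

End Translates.

Section Folner.
Variables (R : realType) (G : groupType).
Implicit Types (F : nat -> {fset G}) (E : set G).

Definition left_folner F : Prop :=
  (forall N, F N != fset0) /\
  forall g : G,
    (#|` fsymdiff (ltranslate g (F N)) (F N)|%:R / #|` F N|%:R : R)
      @[N --> \oo] --> (0 : R).

Definition right_folner F : Prop :=
  (forall N, F N != fset0) /\
  forall g : G,
    (#|` fsymdiff (rtranslate (F N) g) (F N)|%:R / #|` F N|%:R : R)
      @[N --> \oo] --> (0 : R).

Definition amenable : Prop := exists F, left_folner F.

(* The ratios lie in [0, 1], so the real-valued limit superior [limn_sup] is
   the usual one. *)
Definition upper_density F E : R :=
  limn_sup (fun N => #|` [fset x in F N | x \in E]%fset|%:R / #|` F N|%:R).

(* Real suprema of subsets of [0, 1], nonempty as soon as the group is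
   amenable. *)
Definition left_banach_density E : R :=
  sup [set upper_density F E | F in left_folner].

Definition right_banach_density E : R :=
  sup [set upper_density F E | F in right_folner].

End Folner.

Arguments left_folner R {G} F.
Arguments right_folner R {G} F.
Arguments upper_density R {G} F E.
Arguments left_banach_density R {G} E.
Arguments right_banach_density R {G} E.

(* [A A^-1] and [A^-1 A]. *)
Definition set_mulV (G : groupType) (A : set G) : set G :=
  [set (x * y^-1)%g | x in A & y in A].

Definition set_Vmul (G : groupType) (A : set G) : set G :=
  [set (x^-1 * y)%g | x in A & y in A].

(* Main.v *)
Require Import Defs.
From HB Require Import structures.
From mathcomp Require Import all_boot all_order all_algebra finmap.
From mathcomp Require Import all_classical all_reals all_analysis.
From mathcomp Require Import ring lra.

Set Implicit Arguments.
Unset Strict Implicit.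
Unset Printing Implicit Defensive.
Import Order.TTheory GRing.Theory Num.Theory.
Import numFieldNormedType.Exports.
Local Open Scope classical_set_scope.
Local Open Scope ring_scope.

(** Write K = G x G.  For b in G let C b be the set of pairs (x, y) in K x K
    such that (b, 1) x and (1, b^-1) x lie in Al while y (b, 1)^-1 and y (1, b)
    lie in Ar.  If (x, y) belongs to both C b1 and C b2, then (b1, b2) is the
    quotient of (b1, 1) x by (1, b2^-1) x, hence lies in Al Al^-1, and
    likewise in Ar^-1 Ar.  So it suffices to find B of large upper density
    such that the sets C b, b in B, meet pairwise.

    Invariant means replace the two Banach densities: an ultrafilter limit of
    averages over Folner sets gives a left invariant mean p on K with
    p (Al) >= d*_l(Al), and a right invariant mean q with q (Ar) >= d*_r(Ar)
    (exists_invariant_mean).  Their iterated product M is invariant under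
    (x, y) |-> (k x, y k^-1), and by this invariance
    M (C b) = M (A `&` (T b)^-1 A), where A = Al x Ar and T is the action of G
    through the diagonal of K.  A Khintchine-type recurrence bound (khintchine)
    says that the averages of this quantity along F are eventually at least
    M (A)^2 - eps, and M (A)^2 >= d*_l(Al)^2 d*_r(Ar)^2.

    The recurrence bound rests on the positivity of M: if the averages of the
    correlations of the centred function were often below - eps, rapidly
    chosen averages of its translates would be pairwise correlated below
    - eps / 2, and the square of a long sum of them would have a negative mean
    (anticorrelated_sum, avg_correlation_ge).

    Finally, Bergelson's intersectivity principle turns large average mean of
    the C b into one index set B (intersectivity).  Its usual proof applies
    Fatou's lemma to a countably additive measure; M is only finitely
    additive, and the point at which the limsup is large is found instead as
    an ultrafilter V on K x K (ultra_limsup_mean).  With B the set of b such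
    that C b belongs to V, any finitely many of the C b, b in B, meet. *)

(** * Averages over finite sets and Folner sequences *)

Section Average.
Variables (R : realType) (K : choiceType).
Implicit Types (H : {fset K}) (u v : K -> R).

Definition avg H u : R := (\sum_(x <- H) u x) / #|` H|%:R.

Lemma avgD H u v : avg H (fun x => u x + v x) = avg H u + avg H v.
Proof. by rewrite /avg big_split mulrDl. Qed.

Lemma avgZ H c u : avg H (fun x => c * u x) = c * avg H u.
Proof. by rewrite /avg -mulr_sumr mulrA. Qed.

Lemma avg_cst H c : H != fset0 -> avg H (fun=> c) = c.
Proof.
rewrite -cardfs_gt0 => H0.
have sumE : \sum_(x <- H) c = c * #|` H|%:R.
  by rewrite card_fset_sum1 natr_sum mulr_sumr; apply: eq_bigr => x _; rewrite mulr1.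
by rewrite /avg sumE mulfK // pnatr_eq0 -lt0n.
Qed.

Lemma avg_ge0 H u : (forall x, 0 <= u x) -> 0 <= avg H u.
Proof. by move=> u0; rewrite divr_ge0 // sumr_ge0. Qed.

Lemma avg_le H u v : (forall x, u x <= v x) -> avg H u <= avg H v.
Proof. by move=> uv; rewrite ler_wpM2r ?invr_ge0// ler_sum. Qed.

Lemma ler_norm_avg H u c : H != fset0 ->
  (forall x, `|u x| <= c) -> `|avg H u| <= c.
Proof.
move=> H0 uc; rewrite normrM (ger0_norm (_ : 0 <= _^-1))//.
rewrite -[leRHS](avg_cst c H0) ler_wpM2r ?invr_ge0//.
by apply: (le_trans (ler_norm_sum _ _ _)); apply: ler_sum.
Qed.

Lemma avg_indic H (E : set K) :
  avg H \1_E = #|` [fset x in H | x \in E]%fset|%:R / #|` H|%:R.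
Proof.
congr (_ / _); rewrite card_fset_sum1 natr_sum big_fset big_mkcond /=.
by rewrite [RHS]big_mkcond/=; apply: eq_bigr => x _; rewrite indicE; case: (x \in E).
Qed.

End Average.

Lemma avg_exchange (R : realType) (K L : choiceType) (H : {fset K})
    (H' : {fset L}) (w : K -> L -> R) :
  avg H (fun x => avg H' (w x)) = avg H' (fun y => avg H (w ^~ y)).
Proof.
rewrite /avg -!mulr_suml exchange_big /= -!mulrA; congr (_ * _); exact: mulrC.
Qed.

Lemma cvg_avg0 (R : realType) (K : choiceType) (H : {fset K})
    (g : K -> nat -> R) : (forall x, g x N @[N --> \oo] --> (0 : R)) ->
  avg H (g ^~ N) @[N --> \oo] --> (0 : R).
Proof.
move=> g0.
have sum0 (r : seq K) : \sum_(x <- r) g x N @[N --> \oo] --> (0 : R).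
  elim: r => [|x r IH]; first by under eq_fun do rewrite big_nil; exact: cvg_cst.
  under eq_fun do rewrite big_cons.
  by have := cvgD (g0 x) IH _; rewrite addr0; exact.
rewrite /avg; have := cvgM (sum0 H) (cvg_cst (#|` H|%:R^-1 : R)) _.
by rewrite mul0r; exact.
Qed.

Lemma sum_symdiff_le (R : realType) (G : groupType) (A B : {fset G})
    (u : G -> R) (c : R) :
  (forall x, `|u x| <= c) ->
  `|\sum_(x <- A) u x - \sum_(x <- B) u x| <= c * #|` fsymdiff A B|%:R.
Proof.
move=> uc.
rewrite (big_fsetID _ (mem B) A) (big_fsetID _ (mem A) B) /=.
have -> : [fset x in A | x \in B]%fset = [fset x in B | x \in A]%fset.
  by apply/fsetP => x; rewrite !inE andbC.
rewrite opprD addrACA subrr add0r.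
have -> : [fset x in A | x \notin B]%fset = (A `\` B)%fset.
  by apply/fsetP => x; rewrite !inE andbC.
have -> : [fset x in B | x \notin A]%fset = (B `\` A)%fset.
  by apply/fsetP => x; rewrite !inE andbC.
have card_le (D : {fset G}) : `|\sum_(x <- D) u x| <= c * #|` D|%:R.
  apply: (le_trans (ler_norm_sum _ _ _)).
  rewrite card_fset_sum1 natr_sum mulr_sumr.
  by apply: ler_sum => x _; rewrite mulr1.
apply: (le_trans (ler_normB _ _)).
have -> : #|` fsymdiff A B| = (#|` (A `\` B)%fset| + #|` (B `\` A)%fset|)%N.
  rewrite /fsymdiff cardfsU (_ : (A `\` B) `&` (B `\` A) = fset0)%fset.
    by rewrite cardfs0 subn0.
  by apply/fsetP => x; rewrite !inE; case: (x \in A); rewrite ?andbF.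
by rewrite natrD mulrDr lerD.
Qed.

Section Folner.
Variables (R : realType) (I : Type) (G : groupType) (T : I -> G -> G).
Implicit Types (F : nat -> {fset G}) (H : {fset G}).

(** Left and right translations, and the maps b |-> h^-1 b and b |-> b h^-1
    needed for correlations, are all covered by an arbitrary family [T] of
    self-maps. *)
Definition folner_for F : Prop :=
  (forall N, F N != fset0) /\
  forall i : I,
    (#|` fsymdiff [fset T i x | x in F N]%fset (F N)|%:R / #|` F N|%:R : R)
      @[N --> \oo] --> (0 : R).

Hypothesis T_inj : forall i, injective (T i).

Lemma avg_translate_le i H (u : G -> R) (c : R) : (forall x, `|u x| <= c) ->
  `|avg H (u \o T i) - avg H u| <=
    c * (#|` fsymdiff [fset T i x | x in H]%fset H|%:R / #|` H|%:R).
Proof.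
move=> uc; rewrite /avg -mulrBl normrM (ger0_norm (_ : 0 <= _^-1))//.
rewrite mulrA ler_wpM2r ?invr_ge0//.
have <- : \sum_(x <- [fset T i x | x in H]%fset) u x = \sum_(x <- H) (u \o T i) x.
  by rewrite big_imfset//=; move=> x y _ _; exact: T_inj.
exact: sum_symdiff_le.
Qed.

Lemma avg_translate_cvg F i (u : G -> R) (c : R) : folner_for F ->
  (forall x, `|u x| <= c) ->
  avg (F N) (u \o T i) - avg (F N) u @[N --> \oo] --> (0 : R).
Proof.
move=> [F0 FT] uc; apply: norm_cvg0.
apply: (@squeeze_cvgr _ _ _ _ (cst 0) (fun N => c * 
  (#|` fsymdiff [fset T i x | x in F N]%fset (F N)|%:R / #|` F N|%:R))).
- by near=> N; rewrite normr_ge0/=; exact: avg_translate_le.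
- exact: cvg_cst.
- by rewrite -(mulr0 c); exact: cvgMr.
Unshelve. all: by end_near. Qed.

End Folner.

(** * Upper density through frequently large averages *)

Section UpperDensity.
Variables (R : realType) (G : groupType).
Implicit Types (F : nat -> {fset G}) (E : set G).

Lemma upper_densityE F E : upper_density R F E = limn_sup (fun N => avg (F N) \1_E : R).
Proof. by congr limn_sup; apply/funext => N; rewrite avg_indic. Qed.

Lemma avg_indic_itv F E N : 0 <= (avg (F N) \1_E : R) <= 1.
Proof.
apply/andP; split; first by apply: avg_ge0 => x; rewrite indicE.
rewrite avg_indic; have [/eqP->|h] := boolP (#|` F N| == 0)%N.
  by rewrite invr0 mulr0.
rewrite ler_pdivrMr ?ltr0n ?lt0n// mul1r ler_nat.
by apply: fsubset_leq_card; apply/fsubsetP => x; rewrite !inE => /andP[].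
Qed.

Lemma density_bounded F E : bounded_fun (fun N => avg (F N) \1_E : R).
Proof.
exists 1; split; first exact: num_real.
move=> M M1 N _ /=; have /andP[h0 h1] := avg_indic_itv F E N.
by rewrite ger0_norm// (le_trans h1)// ltW.
Qed.

Lemma upper_density_gt F E (c : R) : c < upper_density R F E ->
  forall n, exists2 N, (n <= N)%N & c < avg (F N) \1_E.
Proof.
rewrite upper_densityE limn_supE; last exact: density_bounded.
move=> cd n; apply: contrapT => h; move: cd; apply/negP; rewrite -leNgt.
apply: (@le_trans _ _ (sups (fun N => avg (F N) \1_E : R) n)).
  by apply: ge_inf; [exact/bounded_fun_has_lbound_sups/density_bounded|exists n].
apply: ge_sup; first by exists (avg (F n) \1_E); exists n => /=.
move=> _ [N /= nN <-]; rewrite leNgt; apply/negP => h'; apply: h; by exists N.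
Qed.

Lemma upper_density_ge F E (c : R) :
  (forall e : R, 0 < e -> forall n, exists2 N, (n <= N)%N & c - e <= avg (F N) \1_E) ->
  c <= upper_density R F E.
Proof.
move=> h; rewrite upper_densityE limn_supE; last exact: density_bounded.
apply: lb_le_inf; first by exists (sups (fun N => avg (F N) \1_E : R) 0%N); exists 0%N.
move=> _ [n _ <-]; apply/ler_addgt0Pr => e e0; rewrite -lerBlDr.
have [N nN] := h _ e0 n; move=> /le_trans; apply.
apply: ub_le_sup; last by exists N.
exact/has_ubound_sdrop/bounded_fun_has_ubound/density_bounded.
Qed.

End UpperDensity.

Lemma upper_density_ge0 (R : realType) (G : groupType) (F : nat -> {fset G}) E :
  0 <= upper_density R F E.
Proof.
apply: upper_density_ge => e e0 n; exists n => //.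
by have /andP[h _] := avg_indic_itv R F E n; rewrite (le_trans _ h)// sub0r oppr_le0 ltW.
Qed.

(** * Means: positive normalized functionals on bounded functions *)

Section Mean.
Variables (R : realType) (Z : Type).
Implicit Types (u v : Z -> R).

Definition bdd u := exists c : R, forall z, `|u z| <= c.

Lemma bdd_cst (c : R) : bdd (fun=> c).
Proof. by exists `|c|. Qed.

Lemma bddD u v : bdd u -> bdd v -> bdd (fun z => u z + v z).
Proof.
by move=> [c uc] [d vd]; exists (c + d) => z; rewrite (le_trans (ler_normD _ _)) ?lerD.
Qed.

Lemma bddM u v : bdd u -> bdd v -> bdd (fun z => u z * v z).
Proof.
by move=> [c uc] [d vd]; exists (c * d) => z; rewrite normrM ler_pM.
Qed.

Lemma bdd_indic (A : set Z) : bdd \1_A.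
Proof. by exists 1 => z; rewrite indicE normr_nat lern1 leq_b1. Qed.

Lemma bdd_sum (J : Type) (r : seq J) (e : J -> Z -> R) :
  (forall j, bdd (e j)) -> bdd (fun z => \sum_(j <- r) e j z).
Proof.
move=> he; elim: r => [|j r IH].
  by under eq_fun do rewrite big_nil; exact: bdd_cst.
by under eq_fun do rewrite big_cons; exact: bddD.
Qed.

(** A finitely additive probability, presented as its integral.  The functional
    is total, and constrained on bounded functions only. *)
Record mean := Mean {
  mean_val :> (Z -> R) -> R ;
  meanD : forall u v, bdd u -> bdd v ->
    mean_val (fun z => u z + v z) = mean_val u + mean_val v ;
  meanZ : forall (c : R) u, bdd u -> mean_val (fun z => c * u z) = c * mean_val u ;
  mean_ge0 : forall u, bdd u -> (forall z, 0 <= u z) -> 0 <= mean_val u ;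
  mean1 : mean_val (fun=> 1) = 1 }.

Variable m : mean.

Lemma mean_cst c : m (fun=> c) = c.
Proof.
by have := meanZ m c (bdd_cst 1); rewrite mean1 mulr1.
Qed.

Lemma meanB u v : bdd u -> bdd v -> m (fun z => u z - v z) = m u - m v.
Proof.
move=> bu bv; have := meanD m bu (bddM (bdd_cst (-1)) bv).
rewrite meanZ// mulN1r => <-; congr (m _); apply/funext => z.
by rewrite mulN1r.
Qed.

Lemma le_mean u v : bdd u -> bdd v -> (forall z, u z <= v z) -> m u <= m v.
Proof.
move=> bu bv uv; rewrite -subr_ge0 -meanB//; apply: mean_ge0.
  apply: bddD => //; under eq_fun do rewrite -mulN1r.
  by apply: bddM => //; exact: bdd_cst.
by move=> z; rewrite subr_ge0.
Qed.

Lemma ler_norm_mean u (c : R) : (forall z, `|u z| <= c) -> `|m u| <= c.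
Proof.
move=> uc; have bu : bdd u by exists c.
rewrite ler_norml -{2}(mean_cst c) -(mean_cst (- c)).
by rewrite !le_mean//; try exact: bdd_cst;
  move=> z; have := uc z; rewrite ler_norml => /andP[].
Qed.

Lemma mean_sum (J : Type) (r : seq J) (e : J -> Z -> R) :
  (forall j, bdd (e j)) -> m (fun z => \sum_(j <- r) e j z) = \sum_(j <- r) m (e j).
Proof.
move=> he; elim: r => [|j r IH].
  by rewrite big_nil -[RHS](mean_cst 0); congr (m _); apply/funext => z; rewrite big_nil.
rewrite big_cons -IH -meanD//; last exact: bdd_sum.
by congr (m _); apply/funext => z; rewrite big_cons.
Qed.

Lemma mean_avg (K : choiceType) (H : {fset K}) (e : K -> Z -> R) :
  (forall b, bdd (e b)) -> m (fun z => avg H (e ^~ z)) = avg H (fun b => m (e b)).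
Proof.
move=> he; rewrite /avg -mean_sum// mulrC -meanZ; last exact: bdd_sum.
by congr (m _); apply/funext => z; rewrite mulrC.
Qed.

Lemma mean_indicU_le (A B : set Z) : m \1_(A `|` B) <= m \1_A + m \1_B.
Proof.
rewrite -meanD; try exact: bdd_indic.
apply: le_mean; [exact: bdd_indic|by apply: bddD; exact: bdd_indic|].
move=> z; rewrite !indicE in_setU; case: (z \in A); case: (z \in B) => //=; lra.
Qed.

Lemma mean_indic_le (A B : set Z) : A `<=` B -> m \1_A <= m \1_B.
Proof.
move=> AB; apply: le_mean; try exact: bdd_indic.
move=> z; rewrite !indicE ler_nat.
by case: (boolP (z \in A)) => // /set_mem/AB/mem_set ->.
Qed.

Lemma mean_indic_ge0 (A : set Z) : 0 <= m \1_A.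
Proof. by apply: mean_ge0; [exact: bdd_indic|move=> z; rewrite indicE]. Qed.

Lemma mean_indic_le1 (A : set Z) : m \1_A <= 1.
Proof.
rewrite -[leRHS](mean_cst 1); apply: le_mean; [exact: bdd_indic|exact: bdd_cst|].
by move=> z; rewrite indicE lern1 leq_b1.
Qed.

End Mean.

(** * Invariant means attaining the Banach density *)

Section UltraLimit.
Variables (R : realType) (T : Type) (U : set_system T).
Context {UU : UltraFilter U}.

(** The image filter lives on a compact interval, so it clusters at some p; an
    ultrafilter contains each neighbourhood of p or its complement, and
    clustering excludes the complement. *)
Lemma ultra_bounded_cvg (g : T -> R) (c : R) :
  (\forall t \near U, `|g t| <= c) -> cvg (g @ U).
Proof.
move=> gc.
have FF : ProperFilter (g @ U) by apply: fmap_proper_filter; exact: ultra_proper.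
have [|p [_ pcl]] := @segment_compact R (- c) c (g @ U) FF.
  by rewrite /fmap/=; apply: filterS gc => t /=; rewrite ler_norml in_itv.
apply/cvg_ex; exists p => V pV.
have [//|UnV] := in_ultra_setVsetC (g @^-1` V) UU.
have [x [/= nVx Vx]] := pcl (~` V) V UnV pV.
by exfalso; exact: nVx.
Qed.

End UltraLimit.

Section InvariantMean.
Variables (R : realType) (I : Type) (G : groupType) (T : I -> G -> G).
Hypothesis T_inj : forall i, injective (T i).

Definition banach_density (E : set G) : R :=
  sup [set upper_density R F E | F in folner_for R T].

Variable E : set G.
Let a := banach_density E.

(** Following all Folner sequences at once, and only at the terms where the
    density of [E] nearly reaches the supremum [a], lets a limit mean attain
    [a] although each [e] may call for a different sequence. *)
Definition folner_filter : set_system {fset G} := fun W =>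
  exists2 e : R, 0 < e & forall F, folner_for R T F -> 
    \forall N \near \oo, a - e < avg (F N) \1_E -> W (F N).

(** A member of the filter is nonempty because some Folner sequence has upper
    density above [a - e], hence runs through sets of density above [a - e]
    infinitely often. *)
Lemma folner_filter_proper : 0 < a -> ProperFilter folner_filter.
Proof.
move=> a0; split; last split.
- move=> [e e0 h].
  have hs : has_sup [set upper_density R F E | F in folner_for R T].
    by apply: contrapT => /sup_out s0; move: a0; rewrite /a /banach_density s0 ltxx.
  have [_ [F fF <-] /upper_density_gt Fd] := sup_adherent e0 hs.
  have [n _ nP] := h F fF.
  by have [N nN] := Fd n; exact: (nP N nN).
- by exists 1 => // F _; apply: nearW.
- move=> W W' [e e0 hW] [e' e'0 hW'].
  exists (Num.min e e'); first by rewrite lt_min e0.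
  move=> F fF; near=> N => h; split.
    have: a - e < avg (F N) \1_E -> W (F N) by near: N; exact: hW.
    by apply; apply: le_lt_trans h; rewrite lerB// ge_min lexx.
  have: a - e' < avg (F N) \1_E -> W' (F N) by near: N; exact: hW'.
  by apply; apply: le_lt_trans h; rewrite lerB// ge_min lexx orbT.
- move=> W W' WW' [e e0 hW]; exists e => // F fF.
  by apply: filterS (hW _ fF) => N h /h; exact: WW'.
Unshelve. all: by end_near. Qed.

(** The mean is the limit of averages along an ultrafilter refining
    [folner_filter]: invariance holds since averages over Folner sets are
    asymptotically invariant, and the bound since the density of [E] exceeds
    [a - e] on a set of the filter for every [e]. *)
Lemma exists_invariant_mean : 0 < a ->
  exists m : mean R G, (forall i u, bdd u -> m (u \o T i) = m u) /\ a <= m \1_E.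
Proof.
move=> /folner_filter_proper/ultraFilterLemma[U [UU sub]].
have U0 : \forall H \near U, H != fset0.
  by apply: sub; exists 1 => // F [F0 _]; apply: nearW => N _.
have cvgU (u : G -> R) : bdd u -> cvg ((fun H => avg H u) @ U).
  move=> [c uc]; apply: (@ultra_bounded_cvg _ _ _ _ _ c).
  by apply: filterS U0 => H H0; exact: ler_norm_avg.
pose m (u : G -> R) := lim ((fun H => avg H u) @ U).
have mD u v : bdd u -> bdd v -> m (fun z => u z + v z) = m u + m v.
  move=> bu bv; apply/cvg_lim => //; under eq_fun do rewrite avgD.
  by apply: cvgD; exact: cvgU.
have mZ c u : bdd u -> m (fun z => c * u z) = c * m u.
  move=> bu; apply/cvg_lim => //; under eq_fun do rewrite avgZ.
  by apply: cvgMr; exact: cvgU.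
have m_ge0 u : bdd u -> (forall z, 0 <= u z) -> 0 <= m u.
  move=> bu u0; apply: limr_ge; first exact: cvgU.
  by apply: nearW => H; exact: avg_ge0.
have m1 : m (fun=> 1) = 1.
  apply/cvg_lim => //; apply: cvg_near_cst.
  by apply: filterS U0 => H H0; rewrite avg_cst.
exists (Mean mD mZ m_ge0 m1); split => [i u [c uc]|] /=.
  have bT : bdd (u \o T i) by exists c => x; exact: uc.
  apply/eqP; rewrite -subr_eq0; apply/eqP.
  rewrite -limB; [|exact: cvgU|by apply: cvgU; exists c].
  apply/cvg_lim => //; apply/cvgrPdist_lt => e e0.
  apply: sub; exists 1 => // F fF.
  have /cvgrPdist_lt/(_ _ e0) := avg_translate_cvg T_inj i fF uc.
  by apply: filterS => N h _.
apply/ler_addgt0Pr => e e0; rewrite -lerBlDr.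
apply: limr_ge; first by apply: cvgU; exact: bdd_indic.
by apply: sub; exists e => // F fF; apply: nearW => N /ltW.
Qed.

End InvariantMean.

Lemma banach_density_ge0 (R : realType) (I : Type) (G : groupType)
  (T : I -> G -> G) (E : set G) : 0 <= banach_density R T E.
Proof.
rewrite /banach_density; set S := [set _ | _ in _].
have [hs|/sup_out->//] := pselect (has_sup S).
have [_ [F fF _]] := hs.1; apply: le_trans (upper_density_ge0 R F E) _.
by apply: ub_le_sup; [exact: hs.2|exists F].
Qed.

(** * Product of two means *)

Section ProductMean.
Variables (R : realType) (X Y : Type) (p : mean R X) (q : mean R Y).

Let bdd_slice (u : X * Y -> R) x : bdd u -> bdd (fun y => u (x, y)).
Proof. by move=> [c uc]; exists c. Qed.

Let bdd_partial (u : X * Y -> R) : bdd u -> bdd (fun x => q (fun y => u (x, y))).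
Proof. by move=> [c uc]; exists c => x; exact: ler_norm_mean. Qed.

Let prod_val (u : X * Y -> R) := p (fun x => q (fun y => u (x, y))).

Let prodD u v : bdd u -> bdd v ->
  prod_val (fun z => u z + v z) = prod_val u + prod_val v.
Proof.
move=> bu bv; rewrite /prod_val -meanD; try exact: bdd_partial.
by congr (p _); apply/funext => x; rewrite meanD//; exact: bdd_slice.
Qed.

Let prodZ c u : bdd u -> prod_val (fun z => c * u z) = c * prod_val u.
Proof.
move=> bu; rewrite /prod_val -meanZ; try exact: bdd_partial.
by congr (p _); apply/funext => x; rewrite meanZ//; exact: bdd_slice.
Qed.

Let prod_ge0 u : bdd u -> (forall z, 0 <= u z) -> 0 <= prod_val u.
Proof.
move=> bu u0; apply: mean_ge0; first exact: bdd_partial.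
by move=> x; apply: mean_ge0 => //; exact: bdd_slice.
Qed.

Let prod1 : prod_val (fun=> 1) = 1.
Proof. by rewrite /prod_val !mean_cst. Qed.

(** The iterated integral; integrating in the other order may give another
    mean, but invariance in each variable passes to either one. *)
Definition prod_mean : mean R (X * Y) := Mean prodD prodZ prod_ge0 prod1.

Lemma prod_mean_setX (A : set X) (B : set Y) :
  prod_mean \1_(A `*` B) = p \1_A * q \1_B.
Proof.
rewrite mulrC -meanZ; last exact: bdd_indic.
congr (p _); apply/funext => x; rewrite mulrC -meanZ; last exact: bdd_indic.
congr (q _); apply/funext => y; by rewrite !indicE in_setX -natrM mulnb.
Qed.

Lemma prod_mean_comp (f : X -> X) (g : Y -> Y) u :
  (forall v, bdd v -> p (v \o f) = p v) -> (forall v, bdd v -> q (v \o g) = q v) ->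
  bdd u -> prod_mean (fun z => u (f z.1, g z.2)) = prod_mean u.
Proof.
move=> pf qg bu; rewrite [RHS]/=/prod_val/= -[RHS]pf; last exact: bdd_partial.
by congr (p _); apply/funext => x /=; rewrite -[RHS]qg//; exact: bdd_slice.
Qed.

End ProductMean.

(** * Averages of correlations are asymptotically nonnegative *)

Section Correlation.
Variables (R : realType) (Z : Type) (m : mean R Z) (G : groupType).
Variables (tau : G -> G -> G) (F : nat -> {fset G}).
Hypothesis tau_inj : forall h, injective (tau h).
Hypothesis F_folner : folner_for R tau F.
Variables (e : G -> Z -> R) (c d : R) (phi : G -> R).
Hypothesis e_le : forall b z, `|e b z| <= c.
Hypothesis phi_le : forall b, `|phi b| <= d.
Hypothesis phiE : forall h b, m (fun z => e h z * e b z) = phi (tau h b).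

Let bdd_e b : bdd (e b).
Proof. by exists c. Qed.

(** [u] is a sum of [k] averages of [e] over sets [F N] with rapidly growing
    indices.  The last clause says that [u] correlates with later averages as
    [k] copies of [phi] do, which is the Folner property of [F]; so adding one
    more average over an [F N] with [avg (F N) phi < - eps] changes the mean of
    [u ^+ 2] by at most [c ^+ 2 + eps - 2 * k * eps]. *)
Lemma anticorrelated_sum (eps : R) : 0 < eps ->
  (forall n, exists2 N, (n <= N)%N & avg (F N) phi < - eps) ->
  forall k : nat, exists u : Z -> R, [/\ bdd u,
    m (fun z => u z * u z) <= k%:R * (c ^+ 2 + 2 * eps) - eps * k%:R ^+ 2 &
    avg (F N) (fun b => m (fun z => u z * e b z)) - k%:R * avg (F N) phi
      @[N --> \oo] --> (0 : R)].
Proof.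
move=> eps0 often; elim=> [|k [u [bu uu ue]]].
  exists (fun=> 0); split; first exact: bdd_cst.
    under eq_fun do rewrite mul0r.
    by rewrite mean_cst mul0r expr0n mulr0 subr0.
  apply: cvg_near_cst; apply: nearW => N; rewrite mul0r subr0.
  rewrite -[RHS](avg_cst 0 (F_folner.1 N)); congr avg; apply/funext => b.
  by rewrite -[RHS](mean_cst m 0); congr (m _); apply/funext => z; rewrite mul0r.
have [n _ close] : \forall N \near \oo,
    `|avg (F N) (fun b => m (fun z => u z * e b z)) - k%:R * avg (F N) phi| < eps / 2.
  have /cvgrPdist_lt/(_ (eps / 2)) := ue.
  rewrite divr_gt0// => /(_ isT); apply: filterS => N.
  by rewrite sub0r normrN.
have [N nN negN] := often n; have {close nN} := close _ nN.
rewrite ltr_norml => /andP[_ close].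
have F0 := F_folner.1.
pose v z := avg (F N) (e ^~ z).
have vc z : `|v z| <= c by exact: ler_norm_avg.
have bv : bdd v by exists c.
have buv : bdd (fun z => u z * v z) by exact: bddM.
exists (fun z => u z + v z); split; first exact: bddD.
- have -> : (fun z => (u z + v z) * (u z + v z)) =
      (fun z => (u z * u z + 2 * (u z * v z)) + v z * v z).
    by apply/funext => z; ring.
  have b2uv : bdd (fun z => 2 * (u z * v z)) by apply: bddM => //; exact: bdd_cst.
  rewrite meanD; [|by apply: bddD => //; exact: bddM|exact: bddM].
  rewrite meanD//; last exact: bddM.
  rewrite meanZ//.
  have vv : m (fun z => v z * v z) <= c ^+ 2.
    apply: (le_trans (ler_norm _)); apply: ler_norm_mean => z.
    by rewrite normrM expr2 ler_pM.
  have uv : m (fun z => u z * v z) = avg (F N) (fun b => m (fun z => u z * e b z)).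
    rewrite -mean_avg; last by move=> b; exact: bddM.
    by congr (m _); apply/funext => z; rewrite avgZ.
  have uvle : m (fun z => u z * v z) <= eps / 2 - k%:R * eps.
    rewrite uv; have : k%:R * avg (F N) phi <= k%:R * - eps by rewrite ler_wpM2l// ltW.
    by lra.
  rewrite -natr1; move: uu uvle vv; set K : R := k%:R.
  set uu := m _; set uv' := m _; set vv := m _.
  by move=> h1 h2 h3; nra.
(* After exchanging the averages over [F N] and [F M], each h in [F N] contributes
   the effect on [phi] of translating [F M] by [tau h]. *)
have vlim : avg (F M) (fun b => m (fun z => v z * e b z)) - avg (F M) phi
    @[M --> \oo] --> (0 : R).
  have -> : (fun M => avg (F M) (fun b => m (fun z => v z * e b z)) - avg (F M) phi) =
      (fun M => avg (F N) (fun h => avg (F M) (phi \o tau h) - avg (F M) phi)).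
    apply/funext => M.
    rewrite avgD avg_cst//; congr (_ - _).
    rewrite avg_exchange; congr (avg _ _); apply/funext => b.
    have -> : (fun h => (phi \o tau h) b) = (fun h => m (fun z => e h z * e b z)).
      by apply/funext => h; rewrite phiE.
    rewrite -mean_avg; last by move=> h; exact: bddM.
    congr (m _); apply/funext => z.
    by rewrite mulrC -avgZ; congr avg; apply/funext => h; rewrite mulrC.
  by apply: cvg_avg0 => h; exact: (avg_translate_cvg tau_inj h F_folner phi_le).
have := cvgD ue vlim _; rewrite addr0.
rewrite [X in X @ _ --> _](_ : _ = (fun M =>
  (avg (F M) (fun b => m (fun z => u z * e b z)) - k%:R * avg (F M) phi) +
  (avg (F M) (fun b => m (fun z => v z * e b z)) - avg (F M) phi))).
  exact.
apply/funext => M.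
have -> : (fun b => m (fun z => (u z + v z) * e b z)) =
  (fun b => m (fun z => u z * e b z) + m (fun z => v z * e b z)).
  apply/funext => b; rewrite -meanD; try exact: bddM.
  by congr (m _); apply/funext => z; rewrite mulrDl.
by rewrite avgD -natr1; ring.
Qed.

(** The quadratic bound of [anticorrelated_sum] becomes negative for large [k],
    whereas squares have nonnegative mean. *)
Lemma avg_correlation_ge (eps : R) : 0 < eps ->
  \forall N \near \oo, - eps <= avg (F N) phi.
Proof.
move=> eps0; apply: contrapT => hN.
have often n : exists2 N, (n <= N)%N & avg (F N) phi < - eps.
  apply: contrapT => h; apply: hN; exists n => // N /= nN.
  by rewrite leNgt; apply/negP => hlt; apply: h; exists N.
pose k := (Num.truncn ((c ^+ 2 + 2 * eps) / eps)).+1.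
have [u [bu uu _]] := anticorrelated_sum eps0 often k.
have : 0 <= m (fun z => u z * u z).
  by apply: mean_ge0; [exact: bddM|move=> z; rewrite -expr2 sqr_ge0].
move=> /le_trans/(_ uu); apply/negP; rewrite -ltNge.
have : (c ^+ 2 + 2 * eps) / eps < k%:R by exact: truncnS_gt.
rewrite ltr_pdivrMr// => hk.
have k0 : 0 < k%:R :> R by rewrite ltr0n.
rewrite subr_lt0 (_ : eps * _ = k%:R * (k%:R * eps)); last by ring.
by rewrite ltr_pM2l.
Qed.

End Correlation.

(** * Recurrence along a Folner sequence *)

Section Khintchine.
Variables (R : realType) (Z : Type) (m : mean R Z) (G : groupType).
Variable T : G -> Z -> Z.
Hypothesis T_mul : forall b c z, T (b * c)%g z = T b (T c z).
Hypothesis T_inv : forall b u, bdd u -> m (u \o T b) = m u.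
Variables (A : set Z) (F : nat -> {fset G}).

Let al := m \1_A.

Let mean_return b c :
  m (fun z => \1_A (T c z) * \1_A (T b z)) = m \1_(A `&` T (b * c^-1)%g @^-1` A).
Proof.
rewrite -[RHS](T_inv c); last exact: bdd_indic.
congr (m _); apply/funext => z /=.
rewrite !indicE in_setI -natrM mulnb; congr ((_ && _)%:R).
by apply/idP/idP => /set_mem h; apply/mem_set; move: h; rewrite /= -T_mul mulgVK.
Qed.

Let mean_centred (f g : Z -> R) : bdd f -> bdd g -> m f = al -> m g = al ->
  m (fun z => (f z - al) * (g z - al)) = m (fun z => f z * g z) - al ^+ 2.
Proof.
move=> bf bg fa ga; have bK := bdd_cst Z (- al).
have -> : (fun z => (f z - al) * (g z - al)) =
  (fun z => f z * g z + (- al * f z + (- al * g z + al ^+ 2))).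
  by apply/funext => z; ring.
have b2 := bdd_cst Z (al ^+ 2).
rewrite meanD; [|exact: bddM|by apply: bddD; [exact: bddM|apply: bddD; [exact: bddM|]]].
rewrite meanD; [|exact: bddM|by apply: bddD; [exact: bddM|]].
rewrite meanD; [|exact: bddM|by []].
by rewrite mean_cst !meanZ// fa ga; ring.
Qed.

Let correlation b : R := m \1_(A `&` T b @^-1` A) - al ^+ 2.

Let norm_al : `|al| <= 1.
Proof. by rewrite ger0_norm ?mean_indic_ge0// mean_indic_le1. Qed.

Let norm_correlation b : `|correlation b| <= 2.
Proof.
apply: (le_trans (ler_normB _ _)); rewrite [leRHS](_ : 2 = 1 + 1)//.
by rewrite lerD// ?normrX ?exprn_ile1// ger0_norm ?mean_indic_ge0// mean_indic_le1.
Qed.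

Let norm_centred b z : `|\1_A (T b z) - al| <= 2.
Proof.
apply: (le_trans (ler_normB _ _)); rewrite [leRHS](_ : 2 = 1 + 1)//.
by rewrite lerD// indicE normr_nat lern1 leq_b1.
Qed.

(** Apply [avg_correlation_ge] to the translates of [\1_A - al].  By
    [mean_return] the correlation of two translates depends on a quotient of
    their indices: translating by b^-1 makes it h^-1 * b, suited to left Folner
    sequences, and translating by b makes it b * h^-1, suited to right ones. *)
Lemma khintchine (eps : R) : left_folner R F \/ right_folner R F -> 0 < eps ->
  \forall N \near \oo,
    al ^+ 2 - eps <= avg (F N) (fun b => m \1_(A `&` T b @^-1` A)).
Proof.
move=> hF eps0.
have F0 N : F N != fset0 by case: hF => -[].
have bA b : bdd (fun z => \1_A (T b z) : R).
  by exists 1 => z; rewrite indicE normr_nat lern1 leq_b1.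
have mA b : m (fun z => \1_A (T b z)) = al by rewrite -[RHS](T_inv b)//; exact: bdd_indic.
suff : \forall N \near \oo, - eps <= avg (F N) correlation.
  apply: filterS => N; rewrite (avgD _ _ (fun=> - al ^+ 2)) avg_cst//; lra.
case: hF => [[_ lF]|[_ rF]].
- apply: (@avg_correlation_ge _ _ m _ (fun h b => (h^-1 * b)%g) F _ _
    (fun b z => \1_A (T b^-1%g z) - al) 2 2) => //.
  + by move=> h; exact: mulgI.
  + by split => // h; exact: lF.
  + move=> h b; rewrite mean_centred//; congr (_ - _).
    under eq_fun do rewrite mulrC.
    by rewrite mean_return invgK.
- apply: (@avg_correlation_ge _ _ m _ (fun h b => (b * h^-1)%g) F _ _
    (fun b z => \1_A (T b z) - al) 2 2) => //.
  + by move=> h; exact: mulIg.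
  + by split => // h; exact: rF.
  + by move=> h b; rewrite mean_centred// mean_return.
Qed.

End Khintchine.

(** * A reverse Fatou lemma for means *)

Section Fatou.
Variables (R : realType) (Z : Type) (m : mean R Z).
Variables (f : nat -> Z -> R) (a : R).
Hypothesis a_ge0 : 0 <= a.
Hypothesis f_ge0 : forall N z, 0 <= f N z.
Hypothesis f_le1 : forall N z, f N z <= 1.
Hypothesis mean_f : forall eps : R, 0 < eps ->
  forall n, exists2 N, (n <= N)%N & a - eps <= m (f N).

Let bdd_f N : bdd (f N).
Proof. by exists 1 => z; rewrite ger0_norm. Qed.

Definition high i N : set Z := [set z | a - i.+1%:R^-1 <= f N z].

(** A point lying in a window of every level has [limsup f N >= a].  Stopping at
    [k] replaces the countable union over all N >= i, which a finitely additive
    mean does not control, by a finite one. *)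
Definition window i k : set Z :=
  [set z | exists N, [/\ (i <= N)%N, (N <= k)%N & high i N z]].

Lemma windowS i k k' : (k <= k')%N -> window i k `<=` window i k'.
Proof. by move=> kk' z [N [iN Nk h]]; exists N; split => //; exact: leq_trans kk'. Qed.

Lemma window_anti i j k : (i <= j)%N -> window j k `<=` window i k.
Proof.
move=> ij z [N [jN Nk h]]; exists N; split => //; first exact: leq_trans jN.
apply: le_trans h; rewrite /= lerB// lef_pV2 ?posrE ?ltr0n//.
by rewrite ler_nat.
Qed.

(** Otherwise windows of level i have mean below 1/2, and windows of some level
    j have mean below eps / 4, where eps = 1 / (i + 1).  As [f M] is at most
    [a - eps] off the first, at most [a] on the first and off the second, and
    at most 1 elsewhere, its mean would be below [a - eps / 4]. *)
Lemma window_bounded_below :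
  exists2 c : R, 0 < c & forall i, exists k, c <= m \1_(window i k).
Proof.
apply: contrapT => nc.
have small (c : R) : 0 < c -> exists i, forall k, m \1_(window i k) < c.
  move=> c0; apply: contrapT => h; apply: nc; exists c => // i.
  apply: contrapT => h'; apply: h; exists i => k.
  by rewrite ltNge; apply/negP => h''; apply: h'; exists k.
have half_gt0 : 0 < 2^-1 :> R by [].
have [i wi] := small _ half_gt0.
pose eps : R := i.+1%:R^-1.
have eps0 : 0 < eps by rewrite invr_gt0 ltr0n.
have eps4 : 0 < eps / 4 by rewrite divr_gt0.
have [j wj] := small _ eps4.
have [M] := mean_f eps4 (maxn i j).
rewrite geq_max => /andP[iM jM]; apply/negP; rewrite -ltNge.
have wiM := wi M; have wjM := wj M.
have bw k : bdd (\1_(window k M) : Z -> R) by exact: bdd_indic.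
have bound z : f M z <= (a - eps) + (eps * \1_(window i M) z + \1_(window j M) z).
  have jz0 : 0 <= (\1_(window j M) z : R) by rewrite indicE.
  have [/set_mem iz|/negP iz] := boolP (z \in window i M); last first.
    have iz' : ~ high i M z by move=> h; apply/iz/mem_set; exists M.
    rewrite [X in eps * X]indicE (_ : z \in _ = false); last exact/negP.
    by move/negP: iz'; rewrite /high/= -ltNge -/eps; lra.
  rewrite [X in eps * X]indicE mem_set//= mulr1 addrA subrK.
  have [/set_mem jz|/negP jz] := boolP (z \in window j M).
    by rewrite indicE mem_set//=; apply: (le_trans (f_le1 M z)); rewrite lerDr.
  have jz' : ~ high j M z by move=> h; apply/jz/mem_set; exists M.
  have : 0 <= j.+1%:R^-1 :> R by rewrite invr_ge0.
  move/negP: jz'; rewrite /high/= -ltNge => /ltW/le_trans -> //.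
  by rewrite lerD// (le_trans _ jz0)// oppr_le0.
have be : bdd (fun z => eps * \1_(window i M) z) := bddM (bdd_cst Z eps) (bw i).
have bs := bddD be (bw j).
have := le_mean m (bdd_f M) (bddD (bdd_cst Z (a - eps)) bs) bound.
rewrite (meanD m (bdd_cst Z _) bs) (meanD m be (bw j)) mean_cst (meanZ m _ (bw i)).
move=> /le_lt_trans; apply.
by nra.
Qed.

Lemma window_near_sup i (d : R) : 0 < d ->
  exists k, forall k', m \1_(window i k') <= m \1_(window i k) + d.
Proof.
move=> d0; pose S := range (fun k => m \1_(window i k)).
have hS : has_sup S.
  split; first by exists (m \1_(window i 0%N)); exists 0%N.
  by exists 1 => _ [k _ <-]; exact: mean_indic_le1.
have [_ [k _ <-] hk] := sup_adherent d0 hS.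
exists k => k'; rewrite -lerBlDr (le_trans _ (ltW hk))// lerB//.
by apply: ub_le_sup; [exact: hS.2|exists k'].
Qed.

(** Cut the window of level i at a stage [k i] where its mean is within
    [c / 4 * 2^-i] of its supremum over all stages.  A later such window [Q j]
    lies in some window of level i, so it can leave [Q i] only on a set of mean
    at most [c / 4 * 2^-i].  The total loss stays below [c / 2], while [Q j]
    keeps mean at least [3 * c / 4]. *)
Lemma windows_intersect : exists k : nat -> nat, forall j,
  exists z, forall i, (i <= j)%N -> window i (k i) z.
Proof.
have [c c0 wc] := window_bounded_below.
pose t (i : nat) : R := (2 ^+ i)^-1.
have t0 i : 0 < t i by rewrite invr_gt0 exprn_gt0.
have tS i : t i.+1 = t i / 2 by rewrite /t exprS invfM mulrC.
have d0 i : 0 < c / 4 * t i by rewrite mulr_gt0// divr_gt0.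
have [k kP] := choice (fun i => window_near_sup i (d0 i)).
exists k => j; pose Q i := window i (k i).
have loss i : (i <= j)%N -> m \1_(Q j `\` Q i) <= c / 4 * t i.
  move=> ij; pose K := maxn (k i) (k j).
  have QK : m \1_(Q j `\` Q i) + m \1_(Q i) <= m \1_(window i K).
    rewrite -meanD; try exact: bdd_indic.
    apply: le_mean; [by apply: bddD; exact: bdd_indic|exact: bdd_indic|].
    move=> z; rewrite !indicE in_setD.
    have QiK : Q i `<=` window i K by apply: windowS; exact: leq_maxl.
    have QjK : Q j `<=` window i K.
      by apply: subset_trans (window_anti ij); apply: windowS; exact: leq_maxr.
    have [/set_mem/QiK zK|_] := boolP (z \in Q i).
      by rewrite andbF add0r mem_set.
    rewrite andbT addr0 ler_nat.
    by have [/set_mem/QjK zK|_] := boolP (z \in Q j); [rewrite mem_set|].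
  by rewrite -(lerD2r (m \1_(Q i))) (le_trans QK)// addrC kP.
have lower : c - c / 4 * t j <= m \1_(Q j).
  have [k' ck'] := wc j; have := kP j k'; rewrite -/(Q j); lra.
have total n : (n <= j)%N ->
    m \1_[set z | Q j z /\ ~ forall i, (i < n)%N -> Q i z] <= c / 2 * (1 - t n).
  elim: n => [_|n IH nj].
    rewrite (_ : [set _ | _] = set0) ?indic0 ?mean_cst.
      by rewrite /t expr0 invr1 subrr mulr0.
    by apply/seteqP; split => // z [_] /=; case.
  apply: (@le_trans _ _ (m \1_([set z | Q j z /\ ~ forall i, (i < n)%N -> Q i z]
      `|` (Q j `\` Q n)))).
    apply: mean_indic_le => z [Qjz nQ] /=.
    have [Qnz|nQnz] := pselect (Q n z); last by right.
    left; split => // Qz; apply: nQ => i; rewrite ltnS leq_eqVlt => /orP[/eqP->//|].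
    exact: Qz.
  apply: (le_trans (mean_indicU_le _ _ _)).
  have := IH (ltnW nj); have := loss n (ltnW nj); rewrite tS; nra.
apply: contrapT => none.
have : m \1_(Q j) <= c / 2 * (1 - t j).
  apply: le_trans (total j (leqnn j)); apply: mean_indic_le => z Qjz; split => // Qz.
  apply: none; exists z => i; rewrite leq_eqVlt => /orP[/eqP->//|]; exact: Qz.
by have := t0 j; have := lower; nra.
Qed.

(** A window is a finite union, and an ultrafilter containing a finite union
    contains one of its terms. *)
Lemma ultra_window (V : set_system Z) i k : UltraFilter V -> V (window i k) ->
  exists2 N, (i <= N)%N & V (high i N).
Proof.
move=> UV; elim: k => [|k IH] Vw.
  exists i => //; apply: filterS Vw => z [[|N] [iN // _]].
  by move: iN; rewrite leqn0 => /eqP->.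
have [ik|ki] := leqP i k.+1; last first.
  exfalso; have [z [N [iN Nk _]]] := filter_ex Vw.
  by move: (leq_trans iN Nk); rewrite leqNgt ki.
have [Vh|Vnh] := in_ultra_setVsetC (high i k.+1) UV; first by exists k.+1.
apply: IH; apply: filterS2 Vw Vnh => z [N [iN Nk h]] nh.
exists N; split => //; move: Nk; rewrite leq_eqVlt => /orP[/eqP NE|//].
by exfalso; apply: nh; rewrite -NE.
Qed.

(** Reverse Fatou: the ultrafilter plays the role of a point z of the
    Stone-Cech compactification at which [limsup f N z >= a]. *)
Lemma ultra_limsup_mean : exists2 V : set_system Z, UltraFilter V &
  forall eps : R, 0 < eps ->
    forall n, exists2 N, (n <= N)%N & V [set z | a - eps <= f N z].
Proof.
have [k kP] := windows_intersect.
pose D j := [set z | forall i, (i <= j)%N -> window i (k i) z].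
have DF : ProperFilter (filter_from setT D).
  apply: filter_from_proper; last by move=> j _; exact: kP.
  apply: filter_fromT_filter; first by exists 0%N.
  move=> i j; exists (maxn i j) => z h.
  by split => l hl; apply: h; rewrite leq_max hl ?orbT.
have [V [UV DV]] := ultraFilterLemma DF.
exists V => // eps eps0 n.
pose i := maxn n (Num.truncn eps^-1).
have Vi : V (window i (k i)) by apply: DV; exists i => // z; apply.
have [N iN VN] := ultra_window UV Vi.
exists N; first by apply: leq_trans iN; exact: leq_maxl.
apply: filterS VN => z; apply: le_trans; rewrite lerB//.
rewrite -[leRHS]invrK lef_pV2 ?posrE ?ltr0n ?invr_gt0//.
apply: (le_trans (ltW (truncnS_gt _))); rewrite ler_nat ltnS; exact: leq_maxr.
Qed.

End Fatou.

(** * Bergelson's intersectivity principle *)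

Section Intersectivity.
Variables (R : realType) (Z : Type) (m : mean R Z) (G : groupType).
Variables (F : nat -> {fset G}) (C : G -> set Z) (a : R).
Hypothesis F0 : forall N, F N != fset0.
Hypothesis a_ge0 : 0 <= a.
Hypothesis mean_C : forall eps : R, 0 < eps ->
  \forall N \near \oo, a - eps <= avg (F N) (fun b => m \1_(C b)).

(** Take the ultrafilter at which the densities of {b in F N | z in C b} are
    large infinitely often.  Each [F N] is finite, so almost every z for [V]
    induces on [F N] the same subset as [V] does. *)
Lemma intersectivity : exists2 V : set_system Z, UltraFilter V &
  a <= upper_density R F [set b | V (C b)].
Proof.
pose f N z : R := avg (F N) (fun b => \1_(C b) z).
have f0 N z : 0 <= f N z by apply: avg_ge0 => b; rewrite indicE.
have f1 N z : f N z <= 1.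
  by rewrite -[leRHS](avg_cst 1 (F0 N)); apply: avg_le => b; rewrite indicE lern1 leq_b1.
have mf (eps : R) : 0 < eps -> forall n, exists2 N, (n <= N)%N & a - eps <= m (f N).
  move=> eps0 n; have [n' _ h] := mean_C eps0.
  exists (maxn n n'); first exact: leq_maxl.
  rewrite mean_avg; last by move=> b; exact: bdd_indic.
  by apply: h; exact: leq_maxr.
have [V UV Vf] := ultra_limsup_mean a_ge0 f0 f1 mf.
exists V => //; apply: upper_density_ge => eps eps0 n.
have [N nN VN] := Vf _ eps0 n; exists N => //.
have agree (s : seq G) :
    V [set z | forall b, b \in s -> (z \in C b) = (b \in [set b | V (C b)])].
  elim: s => [|b s IH]; first by apply: filterE => z b.
  have Vb : V [set z | (z \in C b) = (b \in [set b | V (C b)])].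
    have [VC|VnC] := in_ultra_setVsetC (C b) UV.
      by apply: filterS (VC) => z Cz; apply/idP/idP => _; exact: mem_set.
    apply: filterS (VnC) => z nCz; apply/idP/idP => /set_mem // VC.
    by have [z' [? ?]] := filter_ex (filterI VC VnC).
  apply: filterS2 Vb IH => z zb zs b'; rewrite inE => /orP[/eqP->//|]; exact: zs.
have [z [fz zF]] := filter_ex (filterI VN (agree (F N))).
rewrite (le_trans fz)// /f /avg.
by under eq_big_seq => b bF do rewrite indicE zF//.
Qed.

End Intersectivity.

(** * The product set of a dense set inside the two quotient sets *)

Theorem theorem1p21 (R : realType) (G : groupType)
    (Gcountable : countable_group G) (Gamenable : amenable R G)
    (Al Ar : set (G * G)%type) (F : nat -> {fset G})
    (hF : left_folner R F \/ right_folner R F) :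
  exists B : set G,
    upper_density R F B >=
      left_banach_density R Al ^+ 2 * right_banach_density R Ar ^+ 2 /\
    B `*` B `<=` set_mulV Al `&` set_Vmul Ar.
Proof.
have -> : left_banach_density R Al = banach_density R (fun g x => (g * x)%g) Al by [].
have -> : right_banach_density R Ar = banach_density R (fun g x => (x * g)%g) Ar by [].
set al := banach_density _ _ _; set ar := banach_density _ _ _.
have al_ge0 : 0 <= al by exact: banach_density_ge0.
have ar_ge0 : 0 <= ar by exact: banach_density_ge0.
(* If a density vanishes, the empty set will do. *)
have [pos|] := boolP ((0 < al) && (0 < ar)); last first.
  rewrite negb_and -!leNgt => h; exists set0; split; last by move=> [? ?] [[]].
  suff -> : al ^+ 2 * ar ^+ 2 = 0 by exact: upper_density_ge0.
  apply/eqP; rewrite mulf_eq0 !sqrf_eq0 !eq_le al_ge0 ar_ge0 !andbT; exact: h.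
move/andP: pos => [al_gt0 ar_gt0].
have [p [p_inv pAl]] := exists_invariant_mean (fun g : G * G => @mulgI _ g) al_gt0.
have [q [q_inv qAr]] := exists_invariant_mean (fun g : G * G => @mulIg _ g) ar_gt0.
pose M := prod_mean p q; pose A := Al `*` Ar.
have MA : al * ar <= M \1_A by rewrite prod_mean_setX ler_pM.
pose act (k : G * G) (z : (G * G) * (G * G)) := ((k * z.1)%g, (z.2 * k^-1)%g).
have actM k l z : act (k * l)%g z = act k (act l z).
  by rewrite /act /= invgM !mulgA.
have M_inv k u : bdd u -> M (u \o act k) = M u.
  by move=> bu; exact: (prod_mean_comp (p_inv k) (q_inv k^-1%g) bu).
pose T (b : G) := act (b, b).
have T_mul b c z : T (b * c)%g z = T b (T c z) by rewrite /T -actM.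
pose C b := act (1%g, b^-1%g) @^-1` A `&` act (b, 1%g) @^-1` A.
(* [act (b, 1)] is [T b] after [act (1, b^-1)], so invariance under the latter
   turns [C b] into a return set of the diagonal action. *)
have MC b : M \1_(C b) = M \1_(A `&` T b @^-1` A).
  rewrite -[RHS](M_inv (1%g, b^-1%g)); last exact: bdd_indic.
  have actE z : T b (act (1%g, b^-1%g) z) = act (b, 1%g) z.
    rewrite /T -actM; congr (act _ z).
    by congr pair; rewrite /= ?mulg1 ?mulgV.
  congr (M _); apply/funext => z; rewrite /= !indicE; congr ((_ : bool)%:R).
  by apply: asbool_equiv_eq; rewrite /C /= actE.
have F0 N : F N != fset0 by case: hF => -[].
have aM : 0 <= M \1_A ^+ 2 by exact: sqr_ge0.
have [|V UV dV] := @intersectivity _ _ M _ F C _ F0 aM.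
  move=> eps eps0; have /funext -> := MC.
  exact: (khintchine T_mul (fun b => M_inv (b, b)) A hF eps0).
exists [set b | V (C b)]; split.
  apply: le_trans dV; rewrite -exprMn lerXn2r ?nnegrE ?mean_indic_ge0//.
  by rewrite mulr_ge0.
move=> [b1 b2] [/= VC1 VC2].
(* One half of the condition for b1 and the other half of that for b2 suffice. *)
have [[x y] [[_ [Al1 Ar1]] [[Al2 Ar2] _]]] := filter_ex (filterI VC1 VC2).
split.
  exists ((b1, 1%g) * x)%g; first exact: Al1.
  exists ((1%g, b2^-1%g) * x)%g; first exact: Al2.
  rewrite invgM mulgA mulgK.
  by congr pair; rewrite /= ?invg1 ?invgK ?mulg1 ?mul1g.
exists (y * (b1, 1%g)^-1)%g; first exact: Ar1.
exists (y * (1%g, b2^-1%g)^-1)%g; first exact: Ar2.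
rewrite invgM invgK mulgA mulgVK.
by congr pair; rewrite /= ?invg1 ?invgK ?mulg1 ?mul1g.
Qed.
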